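(* Let $\mathbf{F}_q$ be the finite field of $q$ elements of characteristic $p$, and let $X$ be the affine variety over $\mathbf{F}_q$ in $\mathbf{A}^n$ defined by $F_1(x_1,\dots,x_n)=\cdots=F_r(x_1,\dots,x_n)=0$, where each $F_j$ is a polynomial over $\mathbf{F}_q$. Let $d_1,\dots,d_n$ be positive integers and let $d=[d_1,\dots,d_n]$ be their least common multiple. Let $D_j$ ($1\le j\le r$) be the degree of the polynomial $F_j$. Let $\mu(d_1,\dots,d_n;D_1,\dots,D_r)$ denote the smallest non-negative integer which is at least as large as $$\frac{d_1+\cdots+d_n-(D_1+\cdots+D_r)d}{\max_{1\le j\le r} D_j}.$$ Then for every positive integer $k$, we have the $p$-adic estimate $$\mathrm{ord}_q N_{d_1,\dots,d_n}(k,X)\ge k\,\mu(d_1,\dots,d_n;D_1,\dots,D_r).$$ Equivalently, for every reciprocal zero (resp. reciprocal pole) $\alpha$ occurring in the decompositions (A) and (B) of the partial zeta function of $X$ recalled in the context, that is, for every $\alpha$ among the numbers $\alpha_a,\beta_b$ of (A) (when (A) applies) and $\alpha_{aj},\beta_{bj}$ of (B), we have the $p$-adic estimate $$\mathrm{ord}_q(\alpha)\ge \mu(d_1,\dots,d_n;D_1,\dots,D_r).$$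
   Context: Let $\bar{\mathbf{F}}_q$ be an algebraic closure of $\mathbf{F}_q$ and $\mathbf{F}_{q^m}\subset\bar{\mathbf{F}}_q$ the subfield with $q^m$ elements. For each positive integer $k$, $N_{d_1,\dots,d_n}(k,X)$ is the number of points $x=(x_1,\dots,x_n)\in X(\bar{\mathbf{F}}_q)$ with $x_i\in\mathbf{F}_{q^{d_ik}}$ for all $1\le i\le n$. The partial zeta function is $$Z_{d_1,\dots,d_n}(X,T)=\exp\Big(\sum_{k=1}^\infty \frac{N_{d_1,\dots,d_n}(k,X)}{k}T^k\Big).$$ The following decompositions are known. (A) If $d_1,\dots,d_n$ can be rearranged so that $d_1|d_2|\cdots|d_n$, then $Z_{d_1,\dots,d_n}(X,T)$ is a rational function, and there are finitely many algebraic integers $\alpha_a,\beta_b$, each of absolute value an integral power of $\sqrt q$, such that $N_{d_1,\dots,d_n}(k,X)=\sum_a\alpha_a^k-\sum_b\beta_b^k$ for every positive integer $k$. (B) For arbitrary positive integers $d_1,\dots,d_n$, with $\zeta_d$ a primitive $d$-th root of unity, there are $d$ rational functions $R_j(T)$ ($1\le j\le d$) with $R_j(0)=1$ and with algebraic integer coefficients such that $Z_{d_1,\dots,d_n}(X,T)=\prod_{j=1}^d R_j(T)^{\zeta_d^j}$; correspondingly there are finitely many algebraic integers $\alpha_{aj},\beta_{bj}$ (the reciprocal poles and reciprocal zeros of the $R_j$), each of absolute value an integral power of $\sqrt q$, such that $N_{d_1,\dots,d_n}(k,X)=\sum_{j=1}^d\zeta_d^j\big(\sum_a\alpha_{aj}^k-\sum_b\beta_{bj}^k\big)$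 for every positive integer $k$. $\mathrm{ord}_q$ denotes the $p$-adic valuation normalized by $\mathrm{ord}_q(q)=1$, extended to algebraic numbers.
   Formalization: The estimate for α in (A) and (B) is stated for those listed α whose total exponent in the zeta function is nonzero; a listed number that cancels (e.g. 1 adjoined to every R_j when d > 1) is not a reciprocal zero or pole and can violate the bound. *)

(* Defs.v *)
From HB Require Import structures.
From mathcomp Require Import all_boot all_order all_algebra all_fingroup all_field finmap.
(* mpoly has to be imported before constructive_ereal: the notations of the two
   files clash when they are imported in the other order. *)
From mathcomp Require Import mpoly.
From mathcomp Require Import classical_sets cardinality constructive_ereal.

Set Implicit Arguments.
Unset Strict Implicit.
Unset Printing Implicit Defensive.

Import Order.TTheory GRing.Theory Num.Theory.

Local Open Scope classical_set_scope.
Local Open Scope ring_scope.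

(* An algebraic closure has at most one subfield with N elements; when it exists
   this is that subfield, as a set, and otherwise it is empty. *)
Definition subfield_of_card (K : fieldType) (N : nat) : set K :=
  [set x | exists E : {fset K},
     [/\ GRing.divring_closed (mem E), #|` E|%fset = N & x \in E]].

Definition is_algebraic_closure (F : fieldType) (K : closedFieldType)
  (iota : {rmorphism F -> K}) : Prop := integralRange iota.

(* fset_set returns the empty set on infinite sets, but the set below is finite
   as soon as all the d i and k are positive. *)
Definition partial_points (F : finFieldType) (K : closedFieldType)
    (iota : {rmorphism F -> K}) (n r : nat) (P : 'I_r -> {mpoly F[n]})
    (d : 'I_n -> nat) (k : nat) : nat :=
  #|` fset_set [set x : {ffun 'I_n -> K} |
        (forall i, subfield_of_card (#|F| ^ (d i * k)) (x i)) /\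
        (forall j, (map_mpoly iota (P j)).@[x] = 0)] |%fset.

(* msize p is the total degree plus one, and msize 0 = 0, so the zero polynomial
   gets degree 0. *)
Definition total_degree (F : fieldType) (n : nat) (p : {mpoly F[n]}) : nat :=
  (msize p).-1.

Definition lcm_weights (n : nat) (d : 'I_n -> nat) : nat :=
  \big[lcmn/1%N]_(i < n) d i.

Definition max_degree (r : nat) (D : 'I_r -> nat) : nat := \max_(j < r) D j.

Definition mu_bound (n r : nat) (d : 'I_n -> nat) (D : 'I_r -> nat) : rat :=
  ((\sum_(i < n) d i)%:R - (\sum_(j < r) D j)%:R * (lcm_weights d)%:R)
    / (max_degree D)%:R.

Lemma exists_nat_ge (x : rat) : exists m : nat, x <= m%:R.
Proof.
exists (Num.bound `|x|); apply: le_trans (ler_norm x) _.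
by apply/ltW/archi_boundP.
Qed.

Definition mu (n r : nat) (d : 'I_n -> nat) (D : 'I_r -> nat) : nat :=
  ex_minn (exists_nat_ge (mu_bound d D)).

(* For q a power of the prime p. *)
Definition ord_nat (p q N : nat) : \bar rat :=
  if N == 0%N then +oo%E else ((logn p N)%:R / (logn p q)%:R)%:E.

(* v is an extension to the algebraic numbers of ord_nat p q; such extensions are
   not unique, and they all take rational values on nonzero numbers. *)
Definition is_ord_ext (p q : nat) (v : algC -> \bar rat) : Prop :=
  [/\ forall x, x != 0 -> v x \is a fin_num,
      forall N : nat, v N%:R = ord_nat p q N,
      forall x y, v (x * y) = (v x + v y)%E
    & forall x y, (Order.min (v x) (v y) <= v (x + y)%R)%E].

Definition weil_integer (q : nat) (a : algC) : Prop :=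
  a \in Aint /\ exists w : int, `|a| = sqrtC q%:R ^ w.

Definition power_sum (s : seq algC) (k : nat) : algC := \sum_(a <- s) a ^+ k.

Definition divisibility_chain (n : nat) (d : 'I_n -> nat) : Prop :=
  exists s : 'S_n, forall i j : 'I_n, (i <= j)%N -> (d (s i) %| d (s j))%N.

Definition decompositionA (q : nat) (N : nat -> nat) (alpha beta : seq algC)
    : Prop :=
  {in alpha ++ beta, forall a, weil_integer q a} /\
  forall k, (0 < k)%N -> (N k)%:R = power_sum alpha k - power_sum beta k.

(* An index j : 'I_d stands for the exponent j.+1, which ranges over 1, ..., d. *)
Definition decompositionB (q : nat) (N : nat -> nat) (d : nat) (zeta : algC)
    (alpha beta : 'I_d -> seq algC) : Prop :=
  (forall j, {in alpha j ++ beta j, forall a, weil_integer q a}) /\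
  forall k, (0 < k)%N -> (N k)%:R =
    \sum_(j < d) zeta ^+ j.+1 * (power_sum (alpha j) k - power_sum (beta j) k).

(* The exponent of 1 - a T in the inverse of
   Z = \prod_b (1 - b T) / \prod_a (1 - a T): a is a reciprocal pole
   or a reciprocal zero of Z iff it is nonzero. *)
Definition multiplicityA (alpha beta : seq algC) (a : algC) : algC :=
  (count_mem a alpha)%:R - (count_mem a beta)%:R.

(* The total exponent of 1 - a T in the inverse of Z = \prod_j R_j ^ (zeta ^ j).
   Since the powers of zeta sum to 0 when d > 1, a number can be added to every
   alpha j without changing Z: it is then listed, but it is neither a reciprocal
   zero nor a reciprocal pole of Z, and its multiplicity is 0. *)
Definition multiplicityB (d : nat) (zeta : algC) (alpha beta : 'I_d -> seq algC)
    (a : algC) : algC :=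
  \sum_(j < d) zeta ^+ j.+1 * multiplicityA (alpha j) (beta j) a.

(* Main.v *)
Require Import Defs.
From HB Require Import structures.
From mathcomp Require Import all_boot all_order all_algebra all_fingroup all_field finmap.
From mathcomp Require Import mpoly.
From mathcomp Require Import classical_sets cardinality constructive_ereal.
From mathcomp Require Import boolp qpoly cyclic zify ring lra.

Set Implicit Arguments.
Unset Strict Implicit.
Unset Printing Implicit Defensive.

Import Order.TTheory GRing.Theory Num.Theory.
Local Open Scope ring_scope.

(** Put [b = q ^ k = p ^ g] and let [d] be the lcm of the [d_l]. Over a ring of
    integers [R] with residue field the field with [b ^ d] elements, the number of
    points is congruent modulo [p ^ M] to the sum of
    [\prod_j (1 - F_j(x) ^ Q)], [Q = (b ^ d - 1) * b ^ M], over Teichmuller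
    representatives [x]. In the multinomial expansion, a monomial [x ^ e] survives
    the summation only if [b ^ (d_l) - 1] divides each [e_l]. By Legendre's formula
    the valuation of a multinomial coefficient of exponents [m_w] is the sum over
    [i < g] of the carries of the base-[b] addition of the [p ^ i * m_w]; a positive
    multiple of [b ^ t - 1] has base-[b] digit sum at least [t * (b - 1)], and digit
    sums are subadditive. Hence, for each of the [g] values of [i], the carries and
    the [d_l] with [e_l = 0] (for which the summation gives a factor [b ^ (d_l)]) add
    up to an integer which is at least the quotient defining [mu], thus at least [mu].

    For the reciprocal zeros and poles, a linear combination of shifts of the sequence
    [N_k = \sum_a c_a * a ^ k] isolates one term [c_a * a ^ k], whose valuation is thus
    at least [k * mu] up to a constant. *)

(** * Digit sums and Legendre's formula *)

Section DigitSum.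
Local Open Scope nat_scope.

Definition legendre (b m : nat) := \sum_(1 <= j < m.+1) m %/ b ^ j.
(* Legendre's formula, read as a definition of the base-[b] digit sum of [m]. *)
Definition digit_sum (b m : nat) := m - b.-1 * legendre b m.

Lemma legendre_widen (b m M : nat) : 1 < b -> m <= M ->
  legendre b m = \sum_(1 <= j < M.+1) m %/ b ^ j.
Proof.
move=> b1 mM; rewrite /legendre [RHS](@big_cat_nat _ _ _ m.+1) //=.
rewrite [X in _ + X]big1_seq ?addn0 // => j /andP[_].
rewrite mem_index_iota => /andP[mj _].
by apply: divn_small; apply: leq_trans mj _; apply/ltnW/ltn_expl.
Qed.

Lemma legendre_superadditive (b m n : nat) : 1 < b ->
  legendre b m + legendre b n <= legendre b (m + n).
Proof.
move=> b1; rewrite (legendre_widen b1 (leq_addr n m)) (legendre_widen b1 (leq_addl m n)).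
rewrite -big_split /=; apply: leq_sum => j _.
have bj : 0 < b ^ j by rewrite expn_gt0 ltnW.
by rewrite leq_divRL // mulnDl leq_add // leq_trunc_div.
Qed.

Lemma legendre_rec (b m r : nat) : 1 < b -> r < b ->
  legendre b (b * m + r) = m + legendre b m.
Proof.
move=> b1 rb; have b0 := ltnW b1.
have [->|m0] := posnP m.
  rewrite muln0 add0n {2}/legendre big_nil addn0 /legendre big1_seq // => j.
  rewrite mem_index_iota => /andP[_ /andP[j0 _]]; apply: divn_small.
  by apply: leq_trans rb _; rewrite -{1}(expn1 b) leq_exp2l.
rewrite /legendre big_ltn; last by rewrite ltnS addn_gt0 muln_gt0 b0 m0.
rewrite expn1 mulnC divnMDl // (divn_small rb) addn0; congr (_ + _).
rewrite big_add1 /=.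
rewrite (_ : \sum_(_ <= _ < _) _ = \sum_(1 <= j < (m * b + r).-1.+1) m %/ b ^ j); last first.
  rewrite prednK ?addn_gt0 ?muln_gt0 ?m0 ?b0 //; apply: eq_bigr => j _.
  by rewrite expnS divnMA divnMDl // (divn_small rb) addn0.
rewrite -legendre_widen //; nia.
Qed.

Lemma legendre_le (b m : nat) : 1 < b -> b.-1 * legendre b m <= m.
Proof.
move=> b1; elim/ltn_ind: m => m IH.
have [->|m0] := posnP m; first by rewrite /legendre big_nil muln0.
have := IH (m %/ b) (ltn_Pdiv b1 m0).
rewrite {2 3}(divn_eq m b) (mulnC _ b) legendre_rec ?ltn_mod ?(ltnW b1) //; nia.
Qed.

Lemma digit_sumE (b m : nat) : 1 < b -> digit_sum b m + b.-1 * legendre b m = m.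
Proof. by move=> b1; rewrite subnK ?legendre_le. Qed.

Lemma digit_sum_le (b m : nat) : digit_sum b m <= m.
Proof. exact: leq_subr. Qed.

Lemma digit_sum0 (b : nat) : digit_sum b 0 = 0.
Proof. by []. Qed.

Lemma digit_sumD (b m n : nat) : 1 < b ->
  digit_sum b (m + n) <= digit_sum b m + digit_sum b n.
Proof.
move=> b1; have := legendre_superadditive m n b1.
have := digit_sumE m b1; have := digit_sumE n b1; have := digit_sumE (m + n) b1; nia.
Qed.

Lemma digit_sum_mull (b w m : nat) : 1 < b ->
  digit_sum b (w * m) <= w * digit_sum b m.
Proof.
move=> b1; elim: w => [|w IH] //.
by rewrite !mulSn; apply: leq_trans (digit_sumD _ _ b1) _; rewrite leq_add2l.
Qed.

Lemma digit_sum_rec (b m r : nat) : 1 < b -> r < b ->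
  digit_sum b (b * m + r) = digit_sum b m + r.
Proof.
move=> b1 rb; have := digit_sumE (b * m + r) b1; have := digit_sumE m b1.
by rewrite legendre_rec //; nia.
Qed.

Lemma digit_sum_shift (b t u v : nat) : 1 < b -> v < b ^ t ->
  digit_sum b (b ^ t * u + v) = digit_sum b u + digit_sum b v.
Proof.
move=> b1; elim: t v => [|t IH] v.
  by rewrite expn0 ltnS leqn0 mul1n => /eqP->; rewrite digit_sum0 !addn0.
have b0 := ltnW b1; have rb : v %% b < b by rewrite ltn_mod.
rewrite expnS => vb; rewrite {1 2}(divn_eq v b) -mulnA (mulnC _ b) addnA -mulnDr.
by rewrite !digit_sum_rec // IH ?addnA // ltn_divLR // mulnC.
Qed.

Lemma digit_sum_pred_expn (b t : nat) : 1 < b ->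
  digit_sum b (b ^ t - 1) = t * b.-1.
Proof.
move=> b1; elim: t => [|t IH] //; have b0 := ltnW b1.
have bt : 0 < b ^ t by rewrite expn_gt0 b0.
rewrite (_ : b ^ t.+1 - 1 = b * (b ^ t - 1) + b.-1); last first.
  by rewrite expnS mulnBr muln1; have := leq_pmulr b bt; lia.
by rewrite digit_sum_rec ?prednK // IH mulSn addnC.
Qed.

(* Adding the two halves of [e = b ^ t * u + v] is a step of reduction modulo
   [b ^ t - 1] which does not increase the digit sum. *)
Lemma digit_sum_ge (b t e : nat) : 1 < b -> 0 < e -> b ^ t - 1 %| e ->
  t * b.-1 <= digit_sum b e.
Proof.
move=> b1; case: t => [|t] //; set T := t.+1.
have bT : 1 < b ^ T by rewrite -(exp1n T) ltn_exp2r.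
elim/ltn_ind: e => e IH e0 dv.
have [eT|Te] := ltnP e (b ^ T).
  suff -> : e = b ^ T - 1 by rewrite digit_sum_pred_expn.
  have := dvdn_leq e0 dv; lia.
have vT : e %% b ^ T < b ^ T by rewrite ltn_mod; lia.
have u0 : 0 < e %/ b ^ T by rewrite divn_gt0 //; lia.
have := divn_eq e (b ^ T); move: (e %/ _) (e %% _) u0 vT => u v u0 vT.
rewrite (mulnC u) => eE.
have uvE : (b ^ T - 1) * u + (u + v) = e.
  by rewrite eE mulnBl mul1n addnA subnK // leq_pmull // ltnW.
have uv_dvd : b ^ T - 1 %| u + v.
  by rewrite -(dvdn_addr _ (dvdn_mulr u (dvdnn (b ^ T - 1)))) uvE.
rewrite eE digit_sum_shift //; apply: leq_trans (digit_sumD u v b1).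
apply: IH => //; last by rewrite addn_gt0 u0.
by rewrite -uvE -[X in X < _]add0n ltn_add2r muln_gt0 u0 subn_gt0 bT.
Qed.

Lemma digit_sum_mul_expn (b m s : nat) : 1 < b ->
  digit_sum b (m * b ^ s) = digit_sum b m.
Proof.
move=> b1; rewrite mulnC -[_ * _]addn0 digit_sum_shift ?addn0 // expn_gt0; lia.
Qed.

Lemma digit_sum_mul_base (b m : nat) : 1 < b -> digit_sum b (m * b) = digit_sum b m.
Proof. exact: (digit_sum_mul_expn m 1). Qed.

(** Going from [t] to [t + 1] multiplies [c * (b ^ t - 1)] by [b] and adds the number with digits
    [c - 1] and [b - c], of digit sum at most [b - 1]. The factor [c] will be some [p ^ i]. *)
Lemma digit_sum_mul_pred_expn (b c t s : nat) : 1 < b -> 0 < c <= b ->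
  digit_sum b (c * ((b ^ t - 1) * b ^ s)) <= t * b.-1.
Proof.
move=> b1 /andP[c0 cb]; rewrite mulnA digit_sum_mul_expn //.
elim: t => [|t IH]; first by rewrite subnn muln0.
have bt : 0 < b ^ t by rewrite expn_gt0 ltnW.
rewrite (_ : c * (b ^ t.+1 - 1) = b * (c * (b ^ t - 1)) + (b * (c - 1) + (b - c))); last first.
  rewrite expnS !mulnBr !muln1 mulnCA.
  have := leq_pmulr c bt; have := leq_pmulr b c0.
  have := leq_mul (leqnn b) (leq_pmulr c bt); lia.
apply: leq_trans (digit_sumD _ _ b1) _; rewrite mulSn addnC; apply: leq_add.
  apply: leq_trans (digit_sumD _ _ b1) _; rewrite (mulnC b) digit_sum_mul_base //.
  by have := digit_sum_le b (c - 1); have := digit_sum_le b (b - c); lia.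
by rewrite mulnC digit_sum_mul_base.
Qed.

(** [p ^ i * m %/ p ^ (g * j)] is [m %/ p ^ (g * j - i)], and [g * j - i] takes every positive value
    exactly once for [i < g] and [j >= 1]. *)
Lemma sum_legendre_expn (p g m : nat) : 1 < p -> 0 < g ->
  \sum_(i < g) legendre (p ^ g) (p ^ i * m) = legendre p m.
Proof.
move=> p1 g0; have p0 := ltnW p1; pose M := p ^ g * m.
have b1 : 1 < p ^ g by rewrite -(exp1n g) ltn_exp2r.
have mM : m <= g * M by rewrite /M; nia.
rewrite (legendre_widen p1 mM).
transitivity (\sum_(i < g) \sum_(1 <= j < M.+1) m %/ p ^ (g * j - i)).
  apply: eq_bigr => i _; rewrite (@legendre_widen _ _ M) //; last first.
    by rewrite leq_mul2r leq_exp2l // ltnW ?orbT.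
  apply: eq_big_nat => j /andP[j0 _].
  have ij : i <= g * j by have := ltn_ord i; nia.
  by rewrite -expnM -{1}(subnKC ij) expnD divnMl // expn_gt0 p0.
rewrite exchange_big /=; elim: M {mM} => [|M IH].
  by rewrite muln0 !big_geq.
rewrite big_nat_recr //= IH mulnS [RHS](@big_cat_nat _ _ _ (g * M).+1) //=; last by lia.
congr (_ + _).
rewrite -{1}[(g * M).+1]add0n big_addn (_ : (g + g * M).+1 - (g * M).+1 = g); last by lia.
rewrite big_mkord (reindex_inj rev_ord_inj); apply: eq_bigr => i _ /=.
by congr (_ %/ p ^ _); have := ltn_ord i; lia.
Qed.

End DigitSum.

(** * Exponents of the multinomial expansion *)

Definition monomial (R : comNzRingType) (n : nat) (x : 'I_n -> R) (e : 'I_n -> nat) : R :=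
  \prod_(l < n) x l ^+ e l.

(* The index set of the multinomial expansion stays implicit: only the condition
   [good] on coefficient and exponent of each of its terms is recorded. *)
Inductive exp_span (R : comNzRingType) (n : nat) (good : nat -> ('I_n -> nat) -> Prop) :
    (('I_n -> R) -> R) -> Prop :=
| exp_span_term c e u : good c e -> exp_span good (fun x => c%:R * u * monomial x e)
| exp_span0 : exp_span good (fun=> 0)
| exp_spanD f h : exp_span good f -> exp_span good h -> exp_span good (fun x => f x + h x)
| exp_span_ext f h : f =1 h -> exp_span good f -> exp_span good h.

Section Span.
Variables (R : comNzRingType) (n : nat).
Implicit Types (good : nat -> ('I_n -> nat) -> Prop) (f h : ('I_n -> R) -> R).

Lemma monomialD (x : 'I_n -> R) (e1 e2 : 'I_n -> nat) :
  monomial x e1 * monomial x e2 = monomial x (fun l => e1 l + e2 l)%N.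
Proof. by rewrite -big_split; apply: eq_bigr => l _; rewrite exprD. Qed.

Lemma exp_span_sub good1 good2 f : (forall c e, good1 c e -> good2 c e) ->
  exp_span good1 f -> exp_span good2 f.
Proof.
move=> sub; elim=> [c e u /sub|  |f1 f2 _ ? _ ?|f1 f2 fE _ ?].
- exact: exp_span_term.
- exact: exp_span0.
- exact: exp_spanD.
- exact: exp_span_ext fE _.
Qed.

Lemma exp_spanN good f : exp_span good f -> exp_span good (fun x => - f x).
Proof.
elim=> [c e u gce|  |f1 f2 _ h1 _ h2|f1 f2 fE _ h1].
- by apply: exp_span_ext (exp_span_term (- u) gce) => x; rewrite mulrN mulNr.
- by apply: exp_span_ext (exp_span0 _ _) => x; rewrite oppr0.
- by apply: exp_span_ext (exp_spanD h1 h2) => x; rewrite opprD.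
- by apply: exp_span_ext h1 => x; rewrite fE.
Qed.

Lemma exp_span_sum good (I : Type) (s : seq I) (F : I -> ('I_n -> R) -> R) :
  (forall i, exp_span good (F i)) -> exp_span good (fun x => \sum_(i <- s) F i x).
Proof.
move=> gF; elim: s => [|i s IH].
  by apply: exp_span_ext (exp_span0 _ _) => x; rewrite big_nil.
by apply: exp_span_ext (exp_spanD (gF i) IH) => x; rewrite big_cons.
Qed.

(** The factor [N] makes room for a binomial coefficient, so that a multinomial expansion can be
    built by iterated binomial expansions. *)
Lemma exp_spanM good1 good2 good3 (N : nat) f h :
  (forall c1 e1 c2 e2, good1 c1 e1 -> good2 c2 e2 ->
     good3 (c1 * c2 * N)%N (fun l => e1 l + e2 l)%N) ->
  exp_span good1 f -> exp_span good2 h -> exp_span good3 (fun x => f x * h x *+ N).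
Proof.
move=> g12; elim=> [c e u gce|  |f1 f2 _ h1 _ h2|f1 f2 fE _ h1] gh.
- elim: gh => [c' e' u' gce'|  |f1 f2 _ h1 _ h2|f1 f2 fE _ h1].
  + apply: exp_span_ext (exp_span_term (u * u') (g12 _ _ _ _ gce gce')) => x.
    by rewrite -monomialD -mulr_natr !natrM; ring.
  + by apply: exp_span_ext (exp_span0 _ _) => x; rewrite mulr0 mul0rn.
  + by apply: exp_span_ext (exp_spanD h1 h2) => x; rewrite mulrDr mulrnDl.
  + by apply: exp_span_ext h1 => x; rewrite fE.
- by apply: exp_span_ext (exp_span0 _ _) => x; rewrite mul0r mul0rn.
- by apply: exp_span_ext (exp_spanD (h1 gh) (h2 gh)) => x; rewrite mulrDl mulrnDl.
- by apply: exp_span_ext (h1 gh) => x; rewrite fE.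
Qed.

End Span.

Section Weights.
Variables (p g n : nat).
Hypotheses (p_pr : prime p) (g0 : (0 < g)%N).
Local Notation b := (p ^ g)%N.

Let p1 : (1 < p)%N := prime_gt1 p_pr.
Let b1 : (1 < b)%N. Proof. by rewrite -(exp1n g) ltn_exp2r. Qed.

(* [C] is the product of the factorials in the denominator of the multinomial
   coefficient [c]. *)
Definition multinomial_weight (D Q c : nat) (e : 'I_n -> nat) : Prop :=
  exists (lam sig : nat -> nat) (C : nat),
    [/\ (c * C = Q`!)%N, logn p C = (\sum_(i < g) lam i)%N
      & forall i, [/\ (sig i + b.-1 * lam i = p ^ i * Q)%N,
          (lam i <= legendre b (p ^ i * Q))%N
        & (\sum_(l < n) digit_sum b (p ^ i * e l) <= D * sig i)%N]].

(** The binomial coefficient completes [Q1! / C1] times [Q2! / C2] to [(Q1 + Q2)! / (C1 * C2)]. The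
    data [lam] and [sig] add up, by superadditivity of [legendre] and subadditivity of
    [digit_sum]. *)
Lemma multinomial_weightM (D Q1 Q2 c1 c2 : nat) (e1 e2 : 'I_n -> nat) :
  multinomial_weight D Q1 c1 e1 -> multinomial_weight D Q2 c2 e2 ->
  multinomial_weight D (Q1 + Q2) (c1 * c2 * 'C(Q1 + Q2, Q2)) (fun l => e1 l + e2 l)%N.
Proof.
move=> [lam1 [sig1 [C1 [cC1 lg1 H1]]]] [lam2 [sig2 [C2 [cC2 lg2 H2]]]].
exists (fun i => lam1 i + lam2 i)%N, (fun i => sig1 i + sig2 i)%N, (C1 * C2)%N; split.
- rewrite -(@bin_fact (Q1 + Q2) Q2) ?leq_addl // addnK -cC1 -cC2; ring.
- rewrite lognM ?lg1 ?lg2 ?big_split //.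
    by case: C1 cC1 {lg1} => //; rewrite muln0 => /esym/eqP; rewrite -leqn0 leqNgt fact_gt0.
  by case: C2 cC2 {lg2} => //; rewrite muln0 => /esym/eqP; rewrite -leqn0 leqNgt fact_gt0.
move=> i; have [E1 L1 S1] := H1 i; have [E2 L2 S2] := H2 i; split.
- by rewrite [RHS]mulnDr -E1 -E2; ring.
- by rewrite mulnDr (leq_trans _ (legendre_superadditive _ _ b1)) ?leq_add.
- rewrite mulnDr; apply: leq_trans (leq_add S1 S2); rewrite -big_split /=.
  by apply: leq_sum => l _; rewrite mulnDr digit_sumD.
Qed.

(** For a power of a single term, [lam] and [sig] are exactly the Legendre sum and the digit sum of
    [p ^ i * Q]. *)
Lemma multinomial_weight1 (D Q : nat) (e : 'I_n -> nat) :
  (\sum_(l < n) e l <= D)%N -> multinomial_weight D Q 1 (fun l => e l * Q)%N.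
Proof.
move=> eD; exists (fun i => legendre b (p ^ i * Q)), (fun i => digit_sum b (p ^ i * Q)), Q`!.
split=> [||i]; first by rewrite mul1n.
  by rewrite logn_fact // sum_legendre_expn.
split=> //; first exact: digit_sumE.
apply: leq_trans (leq_mul eD (leqnn _)); rewrite big_distrl /=.
by apply: leq_sum => l _; rewrite mulnCA digit_sum_mull.
Qed.

Lemma exp_span_expr (R : comNzRingType) (D Q : nat) (I : eqType) (W : seq I) (a : I -> R)
    (w : I -> 'I_n -> nat) :
  {in W, forall j, \sum_(l < n) w j l <= D}%N ->
  exp_span (multinomial_weight D Q) (fun x => (\sum_(j <- W) a j * monomial x (w j)) ^+ Q).
Proof.
elim: W Q => [|j W IH] Q wD.
  (* The empty sum to the power [0] is [1], not [0]. *)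
  have [->|Q0] := posnP Q.
    have W0 : multinomial_weight D 0 1 (fun _ => 0 * 0)%N.
      by apply: multinomial_weight1; rewrite big1.
    apply: exp_span_ext (exp_span_term 1 W0) => x.
    by rewrite /monomial big1 ?mulr1.
  by apply: exp_span_ext (exp_span0 _ _) => x; rewrite big_nil expr0n eqn0Ngt Q0.
have S : exp_span (multinomial_weight D Q) (fun x : 'I_n -> R => \sum_(i <- index_enum 'I_Q.+1)
    (a j * monomial x (w j)) ^+ (Q - i) * (\sum_(j <- W) a j * monomial x (w j)) ^+ i *+ 'C(Q, i)).
  apply: exp_span_sum => i; have iQ : (i <= Q)%N by rewrite -ltnS.
  apply: (@exp_spanM _ _ (multinomial_weight D (Q - i)) (multinomial_weight D i)).
  - move=> c1 e1 c2 e2 W1 W2; have := multinomial_weightM W1 W2.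
    by rewrite subnK.
  - have W1 := multinomial_weight1 (Q - i) (wD j (mem_head j W)).
    apply: exp_span_ext (exp_span_term (a j ^+ (Q - i)) W1) => x.
    rewrite mul1r exprMn; congr (_ * _); rewrite /monomial -prodrXl.
    by apply: eq_bigr => l _; rewrite exprM.
  - by apply: IH => k kW; apply: wD; rewrite inE kW orbT.
by apply: exp_span_ext S => x; rewrite big_cons exprDn.
Qed.

(* [gam i] is the number of carries in base [b] after multiplication by [p ^ i]; [D]
   is the largest degree of the system and [B] its total degree multiplied by [d]. *)
Definition weight (D B c : nat) (e : 'I_n -> nat) : Prop :=
  exists gam : nat -> nat, (p ^ (\sum_(i < g) gam i) %| c)%N /\
    forall i, (i < g)%N ->
      (\sum_(l < n) digit_sum b (p ^ i * e l) <= b.-1 * (D * gam i + B))%N.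

(** The carries are [legendre b (p ^ i * Q) - lam i]; by Legendre's formula they sum to the
    valuation of [c = Q! / C]. Then [sig i] exceeds the digit sum of [p ^ i * Q], which is at most
    [t * (b - 1)], by [b - 1] times the carries. *)
Lemma multinomial_weightW (D Dj t s c : nat) (e : 'I_n -> nat) : (Dj <= D)%N ->
  multinomial_weight Dj ((b ^ t - 1) * b ^ s) c e -> weight D (t * Dj) c e.
Proof.
move=> DjD [lam [sig [C [cC lgC H]]]]; set Q := ((b ^ t - 1) * b ^ s)%N in cC H.
have cC0 : (0 < c * C)%N by rewrite cC fact_gt0.
have [c0 C0] : (0 < c)%N /\ (0 < C)%N by apply/andP; rewrite -muln_gt0.
exists (fun i => legendre b (p ^ i * Q) - lam i)%N; split.
  rewrite pfactor_dvdn // -(leq_add2r (logn p C)) -lognM // cC logn_fact //.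
  rewrite -[X in (_ <= X)%N]/(legendre p Q) -(@sum_legendre_expn _ g) // lgC -big_split /=.
  by apply/eq_leq/eq_bigr => i _; have [_ h _] := H i; rewrite subnK.
move=> i ig; have [E1 E2 E3] := H i; apply: leq_trans E3 _.
have := digit_sum_mul_pred_expn t s b1 (_ : 0 < p ^ i <= b)%N.
rewrite expn_gt0 prime_gt0 //= leq_exp2l // (ltnW ig) -/Q => /(_ isT) E4.
have := digit_sumE (p ^ i * Q) b1; rewrite -[RHS]E1 => E5.
have -> : sig i = (digit_sum b (p ^ i * Q) + b.-1 * (legendre b (p ^ i * Q) - lam i))%N.
  by rewrite mulnBr; have := leq_mul (leqnn b.-1) E2; lia.
rewrite mulnDr addnC mulnDr; apply: leq_add.
  by rewrite mulnCA leq_mul2l leq_mul2r DjD !orbT.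
by apply: leq_trans (leq_mul (leqnn Dj) E4) _; apply: eq_leq; ring.
Qed.

Lemma weight1 (D B : nat) : weight D B 1 (fun=> 0)%N.
Proof.
exists (fun=> 0)%N; split=> [|i _]; first by rewrite big1.
by rewrite big1 // => l _; rewrite muln0.
Qed.

Lemma weightM (D B1 B2 c1 c2 : nat) (e1 e2 : 'I_n -> nat) :
  weight D B1 c1 e1 -> weight D B2 c2 e2 ->
  weight D (B1 + B2) (c1 * c2) (fun l => e1 l + e2 l)%N.
Proof.
move=> [g1 [d1 H1]] [g2 [d2 H2]]; exists (fun i => g1 i + g2 i)%N; split.
  by rewrite big_split expnD dvdn_mul.
move=> i ig; apply: (@leq_trans (b.-1 * (D * g1 i + B1) + b.-1 * (D * g2 i + B2))); last by lia.
apply: leq_trans (leq_add (H1 i ig) (H2 i ig)); rewrite -big_split /=.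
by apply: leq_sum => l _; rewrite mulnDr digit_sumD.
Qed.

Lemma exp_span_prod (R : comNzRingType) (r D : nat) (B : 'I_r -> nat)
    (F : 'I_r -> ('I_n -> R) -> R) :
  (forall j, exp_span (weight D (B j)) (F j)) ->
  exp_span (weight D (\sum_j B j)) (fun x => \prod_j F j x).
Proof.
move=> H; elim: (index_enum _) => [|j s IH].
  apply: exp_span_ext (exp_span_term 1 _) => [x|]; last by rewrite big_nil; apply: weight1.
  by rewrite big_nil /monomial big1 ?mulr1.
rewrite big_cons; apply: exp_span_ext (exp_spanM (N := 1) _ (H j) IH) => [x|c1 e1 c2 e2].
  by rewrite big_cons.
by rewrite muln1; apply: weightM.
Qed.

(** For each [i], every nonzero [e l] contributes at least [d l * (b - 1)] to the digit sums, so
    these [d l] sum to at most [D * gam i + B]. Adding the sum [I] of the other [d l], with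
    [I <= D * I], gives [m <= gam i + I]; the [g] inequalities are then added. *)
Lemma weight_dvdn (D B m c : nat) (d e : 'I_n -> nat) : (0 < D)%N ->
  (forall X, \sum_l d l <= B + D * X -> m <= X)%N ->
  (forall l, b ^ d l - 1 %| e l)%N -> weight D B c e ->
  (p ^ (g * m) %| c * \prod_(l | e l == 0%N) b ^ d l)%N.
Proof.
move=> D0 mP de [gam [pc H]]; set I := (\sum_(l | e l == 0%N) d l)%N.
rewrite -expn_sum -/I -expnM; apply: dvdn_trans (dvdn_mul pc (dvdnn _)).
rewrite -expnD dvdn_exp2l //.
rewrite -[g in X in (_ <= _ + X)%N]card_ord -[g in X in (X <= _)%N]card_ord.
rewrite -!sum_nat_const -big_split /=.
apply: leq_sum => i _; apply: mP.
rewrite (bigID (fun l => e l == 0%N)) /= -/I.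
suff : (\sum_(l | e l != 0%N) d l <= D * gam i + B)%N.
  move=> H'; rewrite mulnDr addnA [X in (X <= _)%N]addnC.
  by apply: leq_add; [rewrite addnC | exact: leq_pmull].
rewrite -(@leq_pmul2l b.-1) ?ltn_predRL //; apply: leq_trans _ (H i (ltn_ord i)).
rewrite big_distrr /= [X in (_ <= X)%N](bigID (fun l => e l != 0%N)) /=.
rewrite -[X in (X <= _)%N]addn0 leq_add //.
apply: leq_sum => l el; rewrite mulnC digit_sum_ge ?dvdn_mull //.
by rewrite muln_gt0 expn_gt0 prime_gt0 // lt0n.
Qed.

End Weights.

(** * Sums over Teichmuller representatives *)

Definition dvd_pow (R : comNzRingType) (p m : nat) (a : R) : Prop :=
  exists c, a = (p ^ m)%:R * c.

Section DvdPow.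
Variables (R : comNzRingType) (p m : nat).
Implicit Types a c : R.

Lemma dvd_pow0 : dvd_pow p m (0 : R).
Proof. by exists 0; rewrite mulr0. Qed.

Lemma dvd_powD a c : dvd_pow p m a -> dvd_pow p m c -> dvd_pow p m (a + c).
Proof. by move=> [a' ->] [c' ->]; exists (a' + c'); rewrite mulrDr. Qed.

Lemma dvd_powN a : dvd_pow p m a -> dvd_pow p m (- a).
Proof. by move=> [a' ->]; exists (- a'); rewrite mulrN. Qed.

Lemma dvd_powMl a c : dvd_pow p m c -> dvd_pow p m (a * c).
Proof. by move=> [c' ->]; exists (a * c'); rewrite mulrCA. Qed.

Lemma dvd_powMr a c : dvd_pow p m a -> dvd_pow p m (a * c).
Proof. by move=> /(dvd_powMl c); rewrite mulrC. Qed.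

Lemma dvd_pow_sum (I : Type) (s : seq I) (P : pred I) (F : I -> R) :
  (forall i, P i -> dvd_pow p m (F i)) -> dvd_pow p m (\sum_(i <- s | P i) F i).
Proof. by move=> FP; apply: big_ind => //; [apply: dvd_pow0 | apply: dvd_powD]. Qed.

Lemma dvd_powW k a : (m <= k)%N -> dvd_pow p k a -> dvd_pow p m a.
Proof.
move=> mk [c ->]; exists ((p ^ (k - m))%:R * c).
by rewrite mulrA -natrM -expnD subnKC.
Qed.

Lemma dvd_pow_nat (k : nat) : (p ^ m %| k)%N -> dvd_pow p m (k%:R : R).
Proof. by move=> /dvdnP[c ->]; exists c%:R; rewrite -natrM mulnC. Qed.

Lemma dvd_pow_sub_prod (r : nat) (F G : 'I_r -> R) :
  (forall j, dvd_pow p m (F j - G j)) -> dvd_pow p m (\prod_j F j - \prod_j G j).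
Proof.
move=> FG; elim/big_rec2: _ => [|j y2 y1 _ IH]; first by rewrite subrr; apply: dvd_pow0.
rewrite (_ : _ - _ = F j * (y1 - y2) + (F j - G j) * y2); last by ring.
by apply: dvd_powD; [apply: dvd_powMl | apply: dvd_powMr].
Qed.

Lemma dvd_pow_count (I : finType) (P : pred I) (G : I -> R) (A : pred I) :
  (forall x, dvd_pow p m (G x - (P x)%:R)) ->
  dvd_pow p m (\sum_(x in A) G x) -> dvd_pow p m (#|[set x in A | P x]|%:R : R).
Proof.
move=> GP SG.
have -> : #|[set x in A | P x]|%:R = \sum_(x in A) (P x)%:R :> R.
  rewrite -sum1_card natr_sum big_mkcond [RHS]big_mkcond /=; apply: eq_bigr => x _.
  by rewrite inE; case: (x \in A); case: (P x).
rewrite (_ : \sum_(x in A) _ = \sum_(x in A) G x - \sum_(x in A) (G x - (P x)%:R)).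
  by apply: dvd_powD => //; apply: dvd_powN; apply: dvd_pow_sum.
by rewrite -sumrB; apply: eq_bigr => x _; rewrite opprB addrCA subrr addr0.
Qed.

End DvdPow.

Section Lifting.
Variables (R : comNzRingType) (K : fieldType) (rho : {rmorphism R -> K}) (p : nat).
Hypotheses (p_char : p \in [pchar K])
  (p_reg : forall y : R, p%:R * y = 0 -> y = 0)
  (rho_ker : forall y, rho y = 0 -> exists c, y = p%:R * c).

(** Each [p]-th power gains a factor [p]: the cofactor of [x - y] in [x ^ p - y ^ p] is a sum of [p]
    terms with the same image under [rho], hence lies in the kernel, whose elements are multiples of
    [p]. *)
Lemma dvd_pow_expr (M : nat) (a c : R) : rho a = rho c ->
  dvd_pow p M.+1 (a ^+ (p ^ M) - c ^+ (p ^ M)).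
Proof.
move=> ac; elim: M => [|M [u IH]].
  have [|u E] := rho_ker (y := a - c); first by rewrite rmorphB ac subrr.
  by exists u; rewrite !expr1 E expn1.
rewrite expnSr !exprM subrXX IH.
set S := \sum_(i < p) _; have [|v ->] := rho_ker (y := S).
  rewrite rmorph_sum (eq_bigr (fun=> rho (c ^+ (p ^ M)) ^+ p.-1)) => [|i _].
    by rewrite sumr_const card_ord -mulr_natl (pcharf0 p_char) mul0r.
  by rewrite rmorphM !rmorphXn ac -exprD; congr (_ ^+ _); have := ltn_ord i; lia.
by exists (u * v); rewrite [(p ^ M.+2)%N]expnSr natrM; ring.
Qed.

(** [y] need not be a unit of [R]. As [K] is a field, [rho u = 0], so [u = p * u'], and cancelling
    [p] lowers [M] by one. *)
Lemma dvd_pow_cancel (M : nat) (y u : R) : rho y != 0 ->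
  dvd_pow p M (y * u) -> dvd_pow p M u.
Proof.
move=> ry; elim: M u => [|M IH] u; first by move=> _; exists u; rewrite mul1r.
move=> [c yu]; have ru : rho u = 0.
  apply: (mulfI ry); rewrite -rmorphM yu mulr0 rmorphM expnS natrM rmorphM.
  by rewrite rmorph_nat (pcharf0 p_char) !mul0r.
have [u' uE] := rho_ker ru; case: (IH u') => [|v u'E].
  exists c; apply/eqP; rewrite -subr_eq0; apply/eqP/p_reg.
  by rewrite mulrBr [_ * (_%:R * c)]mulrA -natrM -expnS -yu uE; ring.
by exists v; rewrite uE u'E mulrA -natrM -expnS.
Qed.

Lemma dvd_pow_geometric (M N : nat) (z : R) : rho z != 1 ->
  dvd_pow p M (z ^+ N - 1) -> dvd_pow p M (\sum_(a < N) z ^+ a).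
Proof.
by move=> z1; rewrite subrX1; apply: dvd_pow_cancel; rewrite rmorphB rmorph1 subr_eq0.
Qed.

Variables (g n r : nat) (dd : nat) (d : 'I_n -> nat).
Hypotheses (g0 : (0 < g)%N) (dd0 : (0 < dd)%N) (d0 : forall l, (0 < d l)%N)
  (d_dvd : forall l, (d l %| dd)%N).
Local Notation b := (p ^ g)%N.
Local Notation N := (b ^ dd - 1)%N.

Let p_pr : prime p := pcharf_prime p_char.
Let b1 : (1 < b)%N. Proof. by rewrite -(exp1n g) ltn_exp2r // prime_gt1. Qed.

(** [tau] is a Teichmuller lift of [theta] to precision [p ^ M] only: its [N]-th power is merely
    congruent to [1]. *)
Variables (theta : K) (tau : R) (M : nat).
Hypotheses (theta_prim : N.-primitive_root theta) (rho_tau : rho tau = theta)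
  (tauN : dvd_pow p M (tau ^+ N - 1)) (rho_fix : forall y, rho y ^+ (b ^ dd) = rho y).

(** Exponent turning the generator [theta] into a generator of the units of the subfield with
    [b ^ d l] elements. *)
Definition subfield_index (l : 'I_n) : nat := N %/ (b ^ d l - 1).

(* The index [u < b ^ d l] enumerates the subfield with [b ^ d l] elements: [0]
   stands for [0] and [u.+1] for the [u]-th power of a generator. *)
Definition teichmuller (l : 'I_n) (u : 'I_(b ^ dd)) : R :=
  if val u is u'.+1 then tau ^+ (subfield_index l * u') else 0.

Definition subfield_box (l : 'I_n) : pred 'I_(b ^ dd) := [pred u : 'I_(b ^ dd) | (u < b ^ d l)%N].

Lemma pred_expn_dvd l : (b ^ d l - 1 %| N)%N.
Proof.
have /dvdnP[c ->] := d_dvd l; rewrite mulnC expnM.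
by have := dvdn_pred_predX (b ^ d l) c; rewrite !subn1.
Qed.

Lemma subfield_indexK l : (subfield_index l * (b ^ d l - 1) = N)%N.
Proof. exact: divnK (pred_expn_dvd l). Qed.

Lemma rho_teichmuller (l : 'I_n) (u : 'I_(b ^ dd)) :
  rho (teichmuller l u) = if val u is u'.+1 then (theta ^+ subfield_index l) ^+ u' else 0.
Proof.
by rewrite /teichmuller; case: (val u) => [|u']; rewrite ?rmorph0 // rmorphXn rho_tau exprM.
Qed.

Lemma subfield_index_prim l : (b ^ d l - 1).-primitive_root (theta ^+ subfield_index l).
Proof. by rewrite /subfield_index dvdn_prim_root ?pred_expn_dvd. Qed.

Lemma rho_teichmuller_inj l : {in subfield_box l &, injective (fun u => rho (teichmuller l u))}.
Proof.
move=> u v ub vb; rewrite !rho_teichmuller => E; apply: val_inj; move: ub vb E; rewrite !inE.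
have bN : (b ^ d l = (b ^ d l - 1).+1)%N by rewrite subn1 prednK // expn_gt0 (ltnW b1).
have nz i : (theta ^+ subfield_index l) ^+ i != 0.
  rewrite expf_neq0 // (prim_root_eq0 (subfield_index_prim l)) -lt0n.
  exact: prim_order_gt0 (subfield_index_prim l).
case: u v => [[|u'] /= _] [[|v'] /= _] //; rewrite bN => ub vb E.
- by case/eqP: (nz v').
- by case/eqP: (nz u').
- move/eqP: E; rewrite (eq_prim_root_expr (subfield_index_prim l)).
  by rewrite (modn_small (ub : u' < _)%N) (modn_small (vb : v' < _)%N) => /eqP->.
Qed.

Lemma rho_teichmuller_fixed l u : u \in subfield_box l ->
  rho (teichmuller l u) ^+ (b ^ d l) = rho (teichmuller l u).
Proof.
have bN : (b ^ d l = (b ^ d l - 1).+1)%N by rewrite subn1 prednK // expn_gt0 (ltnW b1).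
rewrite rho_teichmuller => _; case: (val u) => [|u']; rewrite bN; first by rewrite expr0n.
by rewrite -exprM mulnC exprM exprS (prim_expr_order (subfield_index_prim l)) mulr1.
Qed.

Lemma rho_teichmuller_surj l y : y ^+ (b ^ d l) = y ->
  exists2 u, u \in subfield_box l & y = rho (teichmuller l u).
Proof.
have bN : (b ^ d l = (b ^ d l - 1).+1)%N by rewrite subn1 prednK // expn_gt0 (ltnW b1).
have le_d : (b ^ d l <= b ^ dd)%N by rewrite leq_exp2l // dvdn_leq.
have [-> _|y0] := eqVneq y 0.
  have u0 : (0 < b ^ dd)%N by rewrite expn_gt0 (ltnW b1).
  by exists (Ordinal u0); rewrite ?rho_teichmuller // inE expn_gt0 (ltnW b1).
rewrite bN exprS -[RHS]mulr1 => /(mulfI y0) /(prim_rootP (subfield_index_prim l)) [i ->].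
have ib : (i.+1 < b ^ d l)%N by have := ltn_ord i; rewrite ltn_subRL.
by exists (Ordinal (leq_trans ib le_d)); rewrite ?rho_teichmuller // inE.
Qed.

(** The index [0] contributes [0 ^+ e], which is [1] for [e = 0]: a zero exponent thus yields the
    full [b ^ d l]. *)
Lemma sum_box (l : 'I_n) (e : nat) :
  \sum_(u | u \in subfield_box l) teichmuller l u ^+ e =
    0 ^+ e + \sum_(a < b ^ d l - 1) (tau ^+ (subfield_index l * e)) ^+ a.
Proof.
have le_d : (b ^ d l <= b ^ dd)%N by rewrite leq_exp2l // dvdn_leq.
transitivity (\sum_(u < b ^ d l) teichmuller l (widen_ord le_d u) ^+ e).
  under eq_bigl do rewrite inE; exact: big_ord_narrow.
rewrite /teichmuller /=; have : (0 < b ^ d l)%N by rewrite expn_gt0 (ltnW b1).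
case: (b ^ d l)%N => // D _; rewrite big_ord_recl subn1 /=; congr (_ + _).
by apply: eq_bigr => a _; rewrite -!exprM; congr (_ ^+ _); rewrite /bump /=; lia.
Qed.

Lemma sum_box0 (l : 'I_n) :
  \sum_(u | u \in subfield_box l) teichmuller l u ^+ 0 = (b ^ d l)%:R :> R.
Proof.
rewrite sum_box expr0 (eq_bigr (fun=> 1)) => [|a _]; last by rewrite muln0 expr0 expr1n.
by rewrite sumr_const card_ord -mulrS subn1 prednK // expn_gt0 (ltnW b1).
Qed.

(** The exponent [e] is nonzero, so only a geometric sum remains. Its ratio has image different from
    [1], while the ratio to the power [b ^ d l - 1] is [tau ^ (N * e)], congruent to [1]. *)
Lemma sum_box_dvd (l : 'I_n) (e : nat) : ~~ (b ^ d l - 1 %| e)%N ->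
  dvd_pow p M (\sum_(u | u \in subfield_box l) teichmuller l u ^+ e).
Proof.
move=> ne; rewrite sum_box expr0n; case: e ne => [|e]; rewrite ?dvdn0 //= => ne.
rewrite add0r; apply: dvd_pow_geometric; last first.
  rewrite -exprM (_ : (_ * _ * _)%N = N * e.+1)%N; last first.
    by rewrite -[in RHS](subfield_indexK l); ring.
  by rewrite exprM subrX1; apply: dvd_powMr.
rewrite rmorphXn rho_tau -(prim_order_dvd theta_prim).
apply: contra ne => H; rewrite -(@dvdn_pmul2l (subfield_index l)) ?subfield_indexK //.
by rewrite -(@ltn_pmul2r (b ^ d l - 1)) ?subfield_indexK ?mul0n ?subn_gt0 -?(expn0 b) ?ltn_exp2l.
Qed.

(** The sum of a monomial over the box factors over the variables. One [e l] not divisible by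
    [b ^ d l - 1] kills it modulo [p ^ M]; otherwise the variables with [e l = 0] supply the powers
    of [b] that occur in [weight_dvdn]. *)
Lemma exp_span_box_dvd (D B m : nat) (f : ('I_n -> R) -> R) : (0 < D)%N ->
  M = (g * m)%N ->
  (forall X, \sum_l d l <= B + D * X -> m <= X)%N ->
  exp_span (weight p g D B) f ->
  dvd_pow p M (\sum_(x in family subfield_box) f (fun l => teichmuller l (x l))).
Proof.
move=> D0 Mm mP; elim=> [c e u ce|  |f1 f2 _ h1 _ h2|f1 f2 fE _ h1]; last 3 first.
- by rewrite big1 //; apply: dvd_pow0.
- by rewrite big_split; apply: dvd_powD.
- by rewrite (eq_bigr (fun x : {ffun _} => f1 (fun l => teichmuller l (x l)))).
rewrite -mulr_sumr.
have -> : \sum_(x in family subfield_box) monomial (fun l => teichmuller l (x l)) e =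
    \prod_l \sum_(u | u \in subfield_box l) teichmuller l u ^+ e l.
  by rewrite bigA_distr_big_dep.
have [dv|] := boolP [forall l, b ^ d l - 1 %| e l]%N; last first.
  rewrite negb_forall => /existsP[l nl]; apply: dvd_powMl.
  by rewrite (bigD1 l) //=; apply: dvd_powMr; apply: sum_box_dvd.
rewrite (bigID (fun l => e l == 0%N)) /= mulrA; apply: dvd_powMr.
rewrite (eq_bigr (fun l => (b ^ d l)%:R)) => [|l /eqP->]; last exact: sum_box0.
rewrite -natr_prod mulrAC; apply: dvd_powMr; rewrite -natrM; apply: dvd_pow_nat.
by rewrite Mm; apply: weight_dvdn mP _ ce => // l; apply: (forallP dv).
Qed.

(** If [rho y = 0], then [y] is a multiple of [p] and the exponent is at least [M]. Otherwise
    [y ^ N] maps to [1], and raising it to the power [b ^ M] brings it to [1] modulo [p ^ M]. *)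
Lemma dvd_pow_indicator (y : R) :
  dvd_pow p M (1 - y ^+ (N * b ^ M) - (rho y == 0)%:R).
Proof.
have N0 : (0 < N)%N by rewrite subn_gt0 -(expn0 b) ltn_exp2l.
have bM : (M <= b ^ M)%N by apply/ltnW/ltn_expl.
have [/eqP y0|y0] := boolP (rho y == 0).
  have [c ->] := rho_ker y0; rewrite mulr1n [1 - _]addrC addrK; apply: dvd_powN.
  apply: (@dvd_powW _ _ _ (N * b ^ M)); first by apply: leq_trans bM (leq_pmull _ N0).
  by exists (c ^+ (N * b ^ M)); rewrite exprMn natrX.
rewrite mulr0n subr0 -opprB; apply: dvd_powN; rewrite exprM -[(b ^ M)%N]expnM.
have -> : 1 = 1 ^+ (p ^ (g * M)) :> R by rewrite expr1n.
apply: dvd_powW _ (dvd_pow_expr _ _); first by rewrite ltnW // ltnS leq_pmull.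
apply: (mulfI y0); rewrite rmorphXn -exprS rmorph1 mulr1 -[in RHS]rho_fix.
by rewrite subn1 prednK // expn_gt0 (ltnW b1).
Qed.

Lemma dvd_pow_card_zeros (D m : nat) (Dj : 'I_r -> nat) (I : 'I_r -> eqType)
    (W : forall j, seq (I j)) (a : forall j, I j -> R) (w : forall j, I j -> 'I_n -> nat) :
  (0 < D)%N -> (forall j, Dj j <= D)%N -> M = (g * m)%N ->
  (forall j, {in W j, forall i, \sum_l w j i l <= Dj j})%N ->
  (forall X, \sum_l d l <= (\sum_j Dj j) * dd + D * X -> m <= X)%N ->
  dvd_pow p M (#|[set x in family subfield_box |
    [forall j, rho (\sum_(i <- W j)
      a j i * monomial (fun l => teichmuller l (x l)) (w j i)) == 0]]|%:R : R).
Proof.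
move=> D0 DjD Mm wD mP.
pose F j (x : 'I_n -> R) := \sum_(i <- W j) a j i * monomial x (w j i).
pose G x := \prod_j (1 - F j x ^+ (N * b ^ M)).
apply: (dvd_pow_count (G := fun x : {ffun 'I_n -> 'I_(b ^ dd)} =>
    G (fun l => teichmuller l (x l)))).
  move=> x; set y := fun l => _.
  rewrite (_ : _%:R = \prod_j (rho (F j y) == 0)%:R); last first.
    have [/forallP H|] := boolP [forall j, rho (F j y) == 0].
      by rewrite big1 // => j _; rewrite H.
    by rewrite negb_forall => /existsP[j /negbTE jF]; rewrite (bigD1 j) //= jF mul0r.
  by apply: dvd_pow_sub_prod => j; apply: dvd_pow_indicator.
apply: (@exp_span_box_dvd D (\sum_j dd * Dj j) m) => //; first by rewrite -big_distrr /= mulnC.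
apply: exp_span_prod => // j.
have W1 : weight (n := n) p g D (dd * Dj j) 1 (fun=> 0)%N by apply: weight1.
apply: exp_span_ext (exp_spanD (exp_span_term 1 W1) (exp_spanN _)) => [x|].
  by rewrite /monomial big1 // !mulr1.
apply: exp_span_sub (exp_span_expr p_pr g0 (N * b ^ M) (a j) (wD j)) => c e.
by apply: multinomial_weightW.
Qed.

End Lifting.

(** * Construction of the ring of integers *)

Section QuotientEval.
Variables (K : fieldType) (theta : K) (h : {poly int}).
Hypotheses (h_monic : h \is monic) (h_size : (1 < size h)%N)
  (h_root : (map_poly intr h).[theta] = 0).

Definition qeval (y : {poly %/ h}) : K := (map_poly intr (y : {poly int})).[theta].

(** [{poly %/ h}] is built on [mk_monic h], which replaces [h] by a default when it is constant or
    not monic. *)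
Let mk_h : mk_monic h = h.
Proof. by rewrite /mk_monic h_size h_monic. Qed.

Lemma horner_rmodp (q : {poly int}) :
  (map_poly intr (Pdiv.Ring.rmodp q (mk_monic h))).[theta] = (map_poly intr q).[theta].
Proof.
rewrite mk_h {2}(Pdiv.RingMonic.rdivp_eq h_monic q) rmorphD rmorphM /=.
by rewrite hornerD hornerM h_root mulr0 add0r.
Qed.

Lemma qeval_is_zmod_morphism : zmod_morphism qeval.
Proof.
move=> x y; rewrite /qeval (_ : polyn (x - y) = polyn x - polyn y) //.
by rewrite rmorphB hornerD hornerN.
Qed.

Lemma qeval_is_monoid_morphism : monoid_morphism qeval.
Proof.
split; first by rewrite /qeval /= rmorph1 hornerC.
by move=> x y; rewrite /qeval poly_of_qpolyM horner_rmodp rmorphM hornerM.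
Qed.

HB.instance Definition _ := GRing.isZmodMorphism.Build _ _ qeval qeval_is_zmod_morphism.
HB.instance Definition _ := GRing.isMonoidMorphism.Build _ _ qeval qeval_is_monoid_morphism.

Definition qeval_morphism : {rmorphism {poly %/ h} -> K} := qeval.

Lemma qeval_in_qpoly (q : {poly int}) : qeval (in_qpoly h q) = (map_poly intr q).[theta].
Proof. exact: horner_rmodp. Qed.

Lemma qpoly_natr_reg (p : nat) (y : {poly %/ h}) : (0 < p)%N -> p%:R * y = 0 -> y = 0.
Proof.
move=> p0; rewrite mulr_natl => E.
have /polyP H : (val y) *+ p = 0 by rewrite -raddfMn E.
apply: val_inj; rewrite [RHS](_ : _ = 0) //; apply/polyP => i.
have /eqP := H i; rewrite coefMn coef0 mulrn_eq0 eqn0Ngt p0.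
by move/eqP.
Qed.

Lemma qpoly_dvd_pow_nat (p M k : nat) : dvd_pow p M (k%:R : {poly %/ h}) -> (p ^ M %| k)%N.
Proof.
move=> [c]; rewrite mulr_natl => /(congr1 (fun y : {poly %/ h} => (val y)`_0)) /=.
rewrite qpolyC_natr raddfMn !coefMn coef1 /= => E.
have : absz (1 *+ k) = (absz ((val c)`_0)%R * p ^ M)%N.
  by rewrite [LHS](congr1 absz E) -mulr_natl abszM natz mulnC.
by rewrite natz => /= ->; apply: dvdn_mull.
Qed.

(** By minimality of [h], a polynomial of smaller size vanishing at [theta] has all its coefficients
    divisible by [p]: a leading term divisible by [p] can be removed, since [p] is zero in [K], and
    a leading coefficient prime to [p] would give a monic polynomial of the same size vanishing at
    [theta]. *)
Lemma qeval_ker (p : nat) : p \in [pchar K] ->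
  (forall f : {poly int}, f \is monic -> (map_poly intr f).[theta] = 0 -> (size h <= size f)%N) ->
  forall y, qeval y = 0 -> exists c, y = p%:R * c.
Proof.
move=> pK hmin y y0; have p_pr := pcharf_prime pK.
have H (f : {poly int}) : (size f < size h)%N -> (map_poly intr f).[theta] = 0 ->
    forall i, (p %| f`_i)%Z.
  move: {2}(size f) (leqnn (size f)) => s; elim: s f => [|s IH] f.
    by rewrite leqn0 size_poly_eq0 => /eqP-> _ _ i; rewrite coef0 dvdz0.
  rewrite leq_eqVlt => /orP[/eqP fs|]; last exact: IH.
  rewrite fs => sh f0.
  have p0 (phi : {rmorphism int -> K}) z : phi (p%:Z * z) = 0.
    by rewrite rmorphM -[p%:Z]natz rmorph_nat (pcharf0 pK) mul0r.
  have [plead|nplead] := boolP (p %| f`_s)%Z.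
    case/dvdzP: (plead) => z zE.
    pose f' := f - f`_s *: 'X^s.
    have f's : (size f' <= s)%N.
      apply/leq_sizeP => j; rewrite leq_eqVlt coefB coefZ coefXn => /orP[/eqP <-|sj].
        by rewrite eqxx mulr1 subrr.
      by rewrite gtn_eqF // mulr0 subr0 nth_default // fs.
    have f'0 : (map_poly intr f').[theta] = 0.
      rewrite rmorphB /= map_polyZ map_polyXn hornerD hornerN hornerZ f0 zE.
      by rewrite [(z * _)%R]mulrC p0 mul0r subr0.
    move=> i; have := IH f' f's (leq_ltn_trans f's (ltnW sh)) f'0 i.
    rewrite coefB coefZ coefXn.
    by have [->|] := eqVneq i s; rewrite ?mulr0 ?subr0.
  have : coprimez p f`_s by rewrite coprimezE prime_coprime.
  (* By Bezout, adding [u * p] to the top coefficient of [v *: f] makes it [1], without changing the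
     value at [theta]. *)
  move=> /coprimezP [[u v] /= uv].
  pose f' := v *: f + (u * p) *: 'X^s.
  have f's : f'`_s = 1 by rewrite coefD !coefZ coefXn eqxx mulr1 addrC.
  have f'size : size f' = s.+1.
    apply/anti_leq/andP; split; last first.
      by rewrite ltnNge; apply/negP => /leq_sizeP/(_ s (leqnn s)); rewrite f's.
    apply: leq_trans (size_polyD _ _) _; rewrite geq_max.
    rewrite (leq_trans (size_scale_leq _ _)) ?fs //=.
    by rewrite (leq_trans (size_scale_leq _ _)) ?size_polyXn.
  have f'm : f' \is monic by rewrite monicE lead_coefE f'size f's.
  have : (size h <= size f')%N.
    apply: hmin f'm _; rewrite rmorphD /= !map_polyZ hornerD !hornerZ f0 mulr0 add0r.
    by rewrite [(u * _)%R]mulrC p0 mul0r.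
  by rewrite f'size leqNgt sh.
have yh : (size (val y) < size h)%N by apply: leq_trans (size_mk_monic y) _; rewrite mk_h.
pose c := (\poly_(i < size (val y)) ((val y)`_i %/ p)%Z)%R.
have cE : val (in_qpoly h c) = c.
  by apply: in_qpoly_small; rewrite mk_h; apply: leq_ltn_trans (size_poly _ _) yh.
exists (in_qpoly h c); apply: val_inj; rewrite mulr_natl.
transitivity (c *+ p); last by rewrite -{1}cE -raddfMn.
apply/polyP => i; rewrite coefMn coef_poly; case: ltnP => iy.
  by rewrite -mulr_natr natz divzK // H.
by rewrite mul0rn nth_default.
Qed.
End QuotientEval.

(** [R] is the quotient of the integer polynomials by a monic [h] of least size vanishing at
    [theta]; ['X^N - 1] shows that one exists. The fourth clause serves to confine the image of
    [rho] to a finite field. *)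
Lemma exists_lifting_ring (K : fieldType) (p N : nat) (theta : K) :
  p \in [pchar K] -> (0 < N)%N -> theta ^+ N = 1 ->
  exists (R : comNzRingType) (rho : {rmorphism R -> K}),
    [/\ forall y : R, p%:R * y = 0 -> y = 0,
        forall y, rho y = 0 -> exists c, y = p%:R * c,
        forall M k, dvd_pow p M (k%:R : R) -> (p ^ M %| k)%N,
        forall y, exists f : {poly int}, rho y = (map_poly intr f).[theta]
      & exists tau, rho tau = theta].
Proof.
move=> pK N0 thetaN.
pose good s :=
  `[< exists f : {poly int}, [/\ f \is monic, (map_poly intr f).[theta] = 0 & size f = s] >].
have ex_good : exists s, good s.
  exists N.+1; apply/asboolP; exists ('X^N - 1); split.
  - exact: monicXnsubC.
  - by rewrite rmorphB /= map_polyXn rmorph1 hornerD hornerN hornerXn hornerC thetaN subrr.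
  - exact: size_XnsubC.
case: (ex_minnP ex_good) => s /asboolP[h [h_monic h_root hs]] smin.
have hmin (f : {poly int}) : f \is monic -> (map_poly intr f).[theta] = 0 -> (size h <= size f)%N.
  by move=> fm f0; rewrite hs; apply: smin; apply/asboolP; exists f.
have h_size : (1 < size h)%N.
  rewrite ltn_neqAle size_poly_gt0 monic_neq0 // andbT; apply/negP => /eqP h1.
  move: h_root; have /size_poly1P[c c0 hE] : size h == 1 by rewrite -h1.
  move: h_monic; rewrite hE monicE lead_coefC => /eqP ->.
  by rewrite rmorph1 hornerC => /eqP; rewrite oner_eq0.
pose rho : {rmorphism {poly %/ h} -> K} := qeval_morphism h_monic h_size h_root.
exists {poly %/ h}, rho; split.
- by move=> y; apply: qpoly_natr_reg; rewrite prime_gt0 ?(pcharf_prime pK).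
- by move=> y; apply: qeval_ker.
- by move=> M k; apply: qpoly_dvd_pow_nat.
- by move=> y; exists (val y).
- exists (in_qpoly h 'X).
  by have := qeval_in_qpoly h_monic h_size h_root 'X; rewrite map_polyX hornerX.
Qed.

(** * Frobenius fixed points, roots of unity and finite subfields *)

Section FrobeniusFixed.
Variables (K : fieldType) (p k : nat).
Hypothesis pK : p \in [pchar K].
Local Notation fixed := (fun x : K => x ^+ (p ^ k) = x).

Lemma exprD_pchar (x y : K) : (x + y) ^+ (p ^ k) = x ^+ (p ^ k) + y ^+ (p ^ k).
Proof.
apply: exprDn_pchar; rewrite (eq_pnat _ (pcharf_eq pK)) pnatX pnat_id ?(pcharf_prime pK) //.
Qed.

Lemma fixedD (x y : K) : fixed x -> fixed y -> fixed (x + y).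
Proof. by move=> xE yE; rewrite /= exprD_pchar xE yE. Qed.

Lemma fixedN (x : K) : fixed x -> fixed (- x).
Proof.
move=> xE; have := exprD_pchar x (- x); rewrite subrr xE expr0n expn_eq0.
by rewrite eqn0Ngt (prime_gt0 (pcharf_prime pK)) /= => /esym /eqP; rewrite addrC addr_eq0 => /eqP.
Qed.

Lemma fixed_horner (theta : K) (f : {poly int}) :
  fixed theta -> fixed (map_poly intr f).[theta].
Proof.
move=> thetaE; elim/poly_ind: f => [|f c IH].
  by rewrite rmorph0 horner0 expr0n expn_eq0 eqn0Ngt (prime_gt0 (pcharf_prime pK)).
rewrite rmorphD rmorphM /= map_polyX map_polyC hornerMXaddC; apply: fixedD.
  by rewrite exprMn IH thetaE.
have fixed_nat (m : nat) : fixed (m%:R).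
  elim: m => [|m IHm]; last by rewrite -natr1; apply: fixedD; rewrite ?expr1n.
  by rewrite expr0n expn_eq0 eqn0Ngt (prime_gt0 (pcharf_prime pK)).
case: c => m /=; first exact: fixed_nat.
by rewrite NegzE rmorphN; apply: fixedN; apply: fixed_nat.
Qed.
End FrobeniusFixed.

(** As [N] is invertible, ['X^N - 1] is separable and has [N] distinct roots; among [N] distinct
    [N]-th roots of unity in a field one is primitive. *)
Lemma exists_prim_root (K : closedFieldType) (N : nat) : N%:R != 0 :> K ->
  exists theta : K, N.-primitive_root theta.
Proof.
move=> N0; have Ngt : (0 < N)%N by case: N N0 => //; rewrite eqxx.
have [rs E] := closed_field_poly_normal ('X^N - 1 : {poly K}).
rewrite lead_coefXnsubC // scale1r in E.
have : has N.-primitive_root rs.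
  apply: has_prim_root => //.
  - apply/allP => x xrs; rewrite /root_of_unity /= E root_prod_XsubC.
    by [].
  - by rewrite -separable_prod_XsubC -E separable_Xn_sub_1.
  - by rewrite -ltnS -(size_prod_XsubC rs id) -E size_XnsubC.
by case/hasP=> x; exists x.
Qed.

(** Multiplication by a nonzero [x] permutes the nonzero elements of [E], so their product can be
    cancelled. *)
Lemma divring_closed_expr_card (K : fieldType) (E : {fset K}) (x : K) :
  GRing.divring_closed (mem E) -> x \in E -> x ^+ #|` E|%fset = x.
Proof.
move=> [E1 EB ED] xE; have E0 : 0 \in E by rewrite -(subrr 1) EB.
have EM y z : y \in E -> z \in E -> y * z \in E.
  by move=> yE zE; rewrite -[z]invrK ED // -[z^-1]mul1r ED.
have [->|x0] := eqVneq x 0.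
  rewrite expr0n cardfs_eq0; case: eqP => // E00; by rewrite E00 inE in E0.
pose s := rem 0 (enum_fset E).
have s_mem y : (y \in s) = (y != 0) && (y \in E) by rewrite mem_rem_uniq ?fset_uniq // inE.
have s_perm : perm_eq s [seq x * y | y <- s].
  apply: uniq_perm; rewrite ?map_inj_uniq ?rem_uniq ?fset_uniq //; first exact: mulfI.
  move=> y; rewrite s_mem; apply/andP/mapP => [[y0 yE]|[z]].
    exists (x^-1 * y); last by rewrite mulVKf.
    by rewrite s_mem mulf_neq0 ?invr_eq0 //= EM // -[x^-1]mul1r ED.
  by rewrite s_mem => /andP[z0 zE] ->; rewrite mulf_neq0 // EM.
have : \prod_(y <- s) y = \prod_(y <- s) (x * y).
  by rewrite [LHS](perm_big _ s_perm) big_map.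
rewrite big_split /= big_const_seq count_predT iter_mulr_1 size_rem // -[LHS]mul1r.
have s0 : \prod_(y <- s) y != 0.
  by rewrite prodf_seq_neq0; apply/allP => y; rewrite s_mem => /andP[].
have Es : (#|` E|%fset = (size (enum_fset E)).-1.+1)%N.
  by rewrite prednK // cardfs_gt0; apply/fset0Pn; exists 0.
by move/(mulIf s0) => H; rewrite Es exprS -H mulr1.
Qed.

(** The fixed points are listed explicitly, as zero and the powers of [theta], to produce the finite
    set that [subfield_of_card] asks for. *)
Lemma subfield_of_cardE (K : closedFieldType) (Q : nat) (theta : K) (x : K) :
  (1 < Q)%N -> (forall y z : K, y ^+ Q = y -> z ^+ Q = z -> (y - z) ^+ Q = y - z) ->
  (Q - 1).-primitive_root theta ->
  (x ^+ Q = x) <-> subfield_of_card Q x.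
Proof.
move=> Q1 fixB prim; have Q0 := ltnW Q1; have N0 := prim_order_gt0 prim.
split=> [xQ|[E [Ediv <- xE]]]; last exact: divring_closed_expr_card.
pose s := 0 :: [seq theta ^+ i | i <- iota 0 (Q - 1)].
have s_mem y : (y \in s) = (y ^+ Q == y).
  rewrite inE; have [->|y0] := eqVneq y 0; first by rewrite expr0n eqn0Ngt Q0 eqxx.
  rewrite -{2}(prednK Q0) exprS -[X in _ == X]mulr1 (inj_eq (mulfI y0)) -subn1 /=.
  apply/mapP/eqP => [[i _ ->]|/(prim_rootP prim)[i ->]].
    by rewrite -exprM mulnC exprM (prim_expr_order prim) expr1n.
  by exists (val i) => //; rewrite mem_iota add0n ltn_ord.
have s_uniq : uniq s.
  rewrite /= map_inj_in_uniq ?iota_uniq; last first.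
    move=> i j; rewrite !mem_iota !add0n => /andP[_ iN] /andP[_ jN] /eqP.
    by rewrite (eq_prim_root_expr prim) !modn_small // => /eqP.
  rewrite andbT; apply/mapP => -[i _ /esym/eqP]; rewrite expf_eq0 (prim_root_eq0 prim) => /andP[_].
  by rewrite eqn0Ngt N0.
have Em (y : K) : (y \in [fset y in s]%fset) = (y ^+ Q == y).
  by rewrite -s_mem; apply/imfsetP/idP => [[z zs ->]|ys] //; exists y.
set E := [fset y in s]%fset in Em; exists E; split.
- split.
  + by change (1 \in E); rewrite Em expr1n.
  + move=> y z; change (y \in E -> z \in E -> y - z \in E).
    by rewrite !Em => /eqP yE /eqP zE; rewrite fixB.
  + move=> y z; change (y \in E -> z \in E -> y / z \in E).
    by rewrite !Em => /eqP yE /eqP zE; rewrite expr_div_n yE zE.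
- by rewrite card_fseq undup_id //= size_map size_iota subn1 prednK.
- by rewrite Em xQ.
Qed.

(** * Counting points *)

(** With the denominator cleared, this is the hypothesis on [m] in [weight_dvdn]. *)
Lemma mu_le (n r : nat) (d : 'I_n -> nat) (D : 'I_r -> nat) (X : nat) :
  (0 < max_degree D)%N ->
  (\sum_l d l <= (\sum_j D j) * lcm_weights d + max_degree D * X)%N -> (mu d D <= X)%N.
Proof.
move=> D0 H; rewrite /mu; case: ex_minnP => m _; apply.
rewrite /mu_bound ler_pdivrMr ?ltr0n // lerBlDr -!natrM -natrD ler_nat.
by rewrite addnC [(X * _)%N]mulnC.
Qed.

Lemma lcm_weights_gt0 (n : nat) (d : 'I_n -> nat) :
  (forall i, 0 < d i)%N -> (0 < lcm_weights d)%N.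
Proof. by move=> d0; apply: (big_ind (fun x => 0 < x)%N) => // x y; rewrite lcmn_gt0 => -> ->. Qed.

Lemma dvdn_lcm_weights (n : nat) (d : 'I_n -> nat) i : (d i %| lcm_weights d)%N.
Proof. by rewrite /lcm_weights (bigD1 i) //= dvdn_lcml. Qed.

Lemma msupp_degree (F : fieldType) (n : nat) (P : {mpoly F[n]}) (m : 'X_{1..n}) :
  m \in msupp P -> (\sum_l m l <= total_degree P)%N.
Proof.
move=> mP; rewrite -mdegE /total_degree -ltnS prednK ?msize_mdeg_lt //.
exact: leq_ltn_trans (leq0n _) (msize_mdeg_lt mP).
Qed.

Lemma meval_map_mpoly (F K : fieldType) (iota : {rmorphism F -> K}) (n : nat)
    (P : {mpoly F[n]}) (x : 'I_n -> K) :
  (map_mpoly iota P).@[x] = \sum_(m <- msupp P) iota P@_m * monomial x m.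
Proof.
rewrite mevalE (perm_big _ (msupp_map_mpoly _ (fmorph_inj iota))) /=.
by apply: eq_bigr => m _; rewrite mcoeff_map_mpoly.
Qed.

Lemma partial_points_dvd (F : finFieldType) (p f : nat) (hp : p \in [pchar F])
    (cardF : #|F| = (p ^ f)%N) (f0 : (0 < f)%N)
    (K : closedFieldType) (iota : {rmorphism F -> K})
    (n r : nat) (P : 'I_r -> {mpoly F[n]})
    (d : 'I_n -> nat) (hd : forall i, (0 < d i)%N)
    (hD : (0 < max_degree (fun j => total_degree (P j)))%N) (k : nat) :
  (0 < k)%N ->
  (p ^ (f * k * mu d (fun j => total_degree (P j))) %| partial_points iota P d k)%N.
Proof.
move=> k0; set m := mu _ _; set dd := lcm_weights d; set g := (f * k)%N; set M := (g * m)%N.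
have pK : p \in [pchar K] := rmorph_pchar iota hp.
have p_pr := pcharf_prime pK; have p1 := prime_gt1 p_pr.
have g0 : (0 < g)%N by rewrite muln_gt0 f0.
have dd0 : (0 < dd)%N := lcm_weights_gt0 hd.
have d_dvd l : (d l %| dd)%N := dvdn_lcm_weights d l.
pose b := (p ^ g)%N; have b1 : (1 < b)%N by rewrite -(exp1n g) ltn_exp2r.
have bdd1 : (1 < b ^ dd)%N by rewrite -(exp1n dd) ltn_exp2r.
(* Such a root exists because [b ^ dd - 1] is [-1] in [K]. *)
have [theta prim] : exists theta : K, (b ^ dd - 1).-primitive_root theta.
  apply: exists_prim_root; rewrite natrB ?(ltnW bdd1) // natrX natrX (pcharf0 pK).
  by rewrite !expr0n (gtn_eqF g0) expr0n (gtn_eqF dd0) sub0r oppr_eq0 oner_eq0.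
have thetaQ : theta ^+ (b ^ dd) = theta.
  by rewrite -[(b ^ dd)%N]prednK ?(ltnW bdd1) // -subn1 exprS (prim_expr_order prim) mulr1.
have [R [rho [p_reg rho_ker dvdE horn [t tE]]]] :=
  exists_lifting_ring pK (prim_order_gt0 prim) (prim_expr_order prim).
have rho_fix y : rho y ^+ (b ^ dd) = rho y.
  by have [q ->] := horn y; rewrite -expnM; apply: fixed_horner => //; rewrite expnM.
(* This exponent is [b ^ (dd * M)]: it leaves the image [theta] unchanged and makes the power
   [b ^ dd - 1] of [tau] congruent to [1] modulo [p ^ M]. *)
pose tau := t ^+ (p ^ (g * dd * M)).
have rho_tau : rho tau = theta.
  rewrite rmorphXn tE expnM expnM; elim: (M) => [|e IHe]; first by rewrite expr1.
  by rewrite expnS exprM thetaQ IHe.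
have tauN : dvd_pow p M (tau ^+ (b ^ dd - 1) - 1).
  rewrite /tau exprAC -[X in _ - X](expr1n _ (p ^ (g * dd * M))).
  apply: dvd_powW _ (dvd_pow_expr pK rho_ker _ _).
    by rewrite ltnW // ltnS leq_pmull // muln_gt0 g0.
  by rewrite rmorphXn tE (prim_expr_order prim) rmorph1.
(* A nonzero coefficient is a power of [theta], since [F] maps into the field with [b ^ dd]
   elements; the same power of [t] lifts it. *)
have lift_coef (a : F) : exists y, rho y = iota a.
  have [->|a0] := eqVneq a 0; first by exists 0; rewrite !rmorph0.
  have aQ : iota a ^+ (b ^ dd - 1) = 1.
    apply: (mulfI (_ : iota a != 0)); first by rewrite fmorph_eq0.
    rewrite -exprS subn1 prednK ?(ltnW bdd1) // mulr1 -rmorphXn; congr (iota _).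
    rewrite /b /g expnM -cardF -expnM; elim: (k * dd)%N => [|e IHe]; first by rewrite expr1.
    by rewrite expnS exprM expf_card.
  by have [i ->] := prim_rootP prim aQ; exists (t ^+ i); rewrite rmorphXn tE.
have [lft lftE] := choice lift_coef.
have main := dvd_pow_card_zeros pK p_reg rho_ker g0 dd0 hd d_dvd prim rho_tau tauN rho_fix
   (D := max_degree (fun j => total_degree (P j))) (m := m) (Dj := fun j => total_degree (P j))
   (W := fun j => msupp (P j)) (fun j mm => lft (P j)@_mm) (w := fun j mm => mm) hD.
have {main} := main (fun j => leq_bigmax j) erefl (fun j mm => @msupp_degree _ _ (P j) mm)
   (fun X => @mu_le _ _ d _ X hD).
move=> /dvdE; set B := [set x in _ | _].
suff -> : partial_points iota P d k = #|B| by [].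
(* Reduction of the representatives identifies the box with the tuples whose coordinates lie in the
   prescribed subfields. *)
pose elt (u : {ffun 'I_n -> 'I_(b ^ dd)}) : {ffun 'I_n -> K} :=
  [ffun l => rho (teichmuller d tau l (u l))].
rewrite /partial_points.
have QE l : (#|F| ^ (d l * k))%N = (b ^ d l)%N.
  by rewrite cardF /b /g -!expnM; congr (_ ^ _)%N; lia.
have subE l (y : K) : y ^+ (b ^ d l) = y <-> subfield_of_card (#|F| ^ (d l * k)) y.
  have primd := subfield_index_prim d_dvd prim l.
  rewrite QE; apply: subfield_of_cardE primd.
    by rewrite -(exp1n (d l)) ltn_exp2r // hd.
  by rewrite -expnM => u v uE vE; apply: (fixedD pK) => //; apply: fixedN.
have BE u : (u \in B) = (u \in family (subfield_box d)) &&
    [forall j, (map_mpoly iota (P j)).@[elt u] == 0].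
  rewrite inE; congr (_ && _); apply: eq_forallb => j; rewrite meval_map_mpoly rmorph_sum /=.
  congr (_ == _); apply: eq_bigr => mm _; rewrite rmorphM lftE; congr (_ * _).
  rewrite /monomial rmorph_prod; apply: eq_bigr => l _; by rewrite rmorphXn ffunE.
(* Writing the set of points as the image of a finite set shows that it is finite, so [fset_set]
   does not take its default value. *)
rewrite (_ : [set x | _]%classic = [set` [fset elt u | u in B]%fset]%classic); last first.
  apply/seteqP; split => [x /= [xs xP]|x /= /imfsetP[u /= uB ->]].
    have ex l : exists u : 'I_((p ^ g) ^ dd),
        u \in subfield_box d l /\ x l = rho (teichmuller d tau l u).
      have /subE xl := xs l.
      by have [u ub uE] := rho_teichmuller_surj pK g0 dd0 d_dvd prim rho_tau xl; exists u.
    have [u uE] := choice ex.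
    have xE : x = elt (finfun u).
      by apply/ffunP => l; rewrite !ffunE; have [_ ->] := uE l.
    apply/imfsetP; exists (finfun u) => //=; rewrite BE; apply/andP; split.
      by apply/familyP => l; rewrite ffunE; have [] := uE l.
    by apply/forallP => j; rewrite -xE; apply/eqP/xP.
  move: uB; rewrite BE => /andP[/familyP ub /forallP uP]; split=> [l|j]; last exact/eqP.
  apply/subE; rewrite ffunE; exact: (rho_teichmuller_fixed pK g0 d_dvd prim rho_tau (ub l)).
rewrite set_fsetK card_in_imfset /= -?cardE // => u v; rewrite !BE.
move=> /andP[/familyP ub _] /andP[/familyP vb _] /ffunP E.
apply/ffunP => l; have := E l; rewrite !ffunE => El.
exact: (rho_teichmuller_inj pK g0 d_dvd prim rho_tau (ub l) (vb l) El).
Qed.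

(** * Reciprocal zeros and poles *)

Section Valuation.
Variables (p q : nat) (v : algC -> \bar rat).
Hypothesis v_ord : is_ord_ext p q v.

Lemma ord_ext0 : v 0 = +oo%E.
Proof. by have [_ vN _ _] := v_ord; rewrite (vN 0%N) /ord_nat eqxx. Qed.

Lemma ord_extX (a : algC) (alpha : rat) (k : nat) :
  v a = alpha%:E -> v (a ^+ k) = (k%:R * alpha)%:E.
Proof.
have [_ vN vM _] := v_ord => va; elim: k => [|k IH].
  by rewrite expr0 (vN 1%N) /ord_nat /= logn1 !mul0r.
by rewrite exprS vM va IH -EFinD -natr1; congr _%:E; ring.
Qed.

Lemma ord_ext_sum (I : Type) (s : seq I) (F : I -> algC) (c : \bar rat) :
  (forall i, c <= v (F i))%E -> (c <= v (\sum_(i <- s) F i)%R)%E.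
Proof.
have [_ _ _ vD] := v_ord => cF; elim/big_ind: _ => //; first by rewrite ord_ext0 leey.
by move=> x y cx cy; apply: le_trans (vD x y); rewrite le_min cx.
Qed.

(** Only [0] has infinite valuation, and it is [+oo]. The bound will serve for the coefficients of a
    shift operator, which do not depend on [k]. *)
Lemma ord_ext_lower_bound (g : nat -> algC) (n : nat) :
  exists low : rat, forall i, (i < n)%N -> (low%:E <= v (g i))%E.
Proof.
have [v_fin _ _ _] := v_ord; elim: n => [|n [low lowP]]; first by exists 0.
have [x xP] : exists x : rat, (x%:E <= v (g n))%E.
  have [->|gn0] := eqVneq (g n) 0; first by exists 0; rewrite ord_ext0 leey.
  by exists (fine (v (g n))); rewrite fineK ?v_fin.
exists (Num.min low x) => i; rewrite ltnS leq_eqVlt => /orP[/eqP ->|/lowP lowi].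
  by apply: le_trans xP; rewrite lee_fin ge_min lexx orbT.
by apply: le_trans lowi; rewrite lee_fin ge_min lexx.
Qed.

(* Applying the shift operator [\prod_(b != a) (T - b)] to the sequence of sums
   leaves a geometric sequence of ratio [a]. *)
Lemma ord_ext_exponential_sum (s : seq algC) (c : algC -> algC) (m : nat) :
  uniq s ->
  (forall k, (0 < k)%N -> ((k * m)%:R%:E <= v (\sum_(b <- s) c b * b ^+ k)%R)%E) ->
  forall a, a \in s -> c a != 0 -> (m%:R%:E <= v a)%E.
Proof.
have [v_fin _ vM _] := v_ord => s_uniq sumP a a_s ca0.
have [->|a0] := eqVneq a 0; first by rewrite ord_ext0 leey.
pose g := \prod_(b <- rem a s) ('X - b%:P).
have g_root b : b \in s -> (g.[b] == 0) = (b != a).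
  by move=> bs; rewrite -/(root g b) root_prod_XsubC mem_rem_uniq // !inE bs andbT.
have [low lowP] := ord_ext_lower_bound (fun i => g`_i) (size g).
pose C := c a * g.[a]; have C0 : C != 0 by rewrite mulf_neq0 // g_root ?eqxx.
have shift k : \sum_(i < size g) g`_i * (\sum_(b <- s) c b * b ^+ (k + i)) = C * a ^+ k.
  transitivity (\sum_(b <- s) c b * b ^+ k * g.[b]).
    under eq_bigr do rewrite mulr_sumr; rewrite exchange_big /=; apply: eq_bigr => b _.
    by rewrite horner_coef mulr_sumr; apply: eq_bigr => i _; rewrite exprD; ring.
  rewrite (bigD1_seq a) //= big1_seq ?addr0 => [|b /andP[ba bs]]; first by rewrite /C; ring.
  by move: (g_root b bs); rewrite ba => /eqP ->; rewrite mulr0.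
pose gam := fine (v C); pose alpha := fine (v a).
have vC : v C = gam%:E by rewrite fineK ?v_fin.
have va : v a = alpha%:E by rewrite fineK ?v_fin.
have bound k : (0 < k)%N -> low + k%:R * m%:R <= gam + k%:R * alpha.
  move=> k0; rewrite -lee_fin [X in (_ <= X)%E]EFinD -vC -(ord_extX _ va) -vM -shift.
  apply: ord_ext_sum => i; rewrite vM EFinD; apply: leeD; first exact: lowP.
  have ki : (0 < k + i)%N by rewrite addn_gt0 k0.
  apply: le_trans (sumP _ ki); rewrite lee_fin -natrM ler_nat leq_mul2r leq_addr orbT.
  by [].
(* [gam] and [low] do not depend on [k], so a slope [alpha < m] would contradict [bound] for large
   [k]. *)
rewrite va lee_fin leNgt; apply/negP => am.
have am0 : 0 < m%:R - alpha by rewrite subr_gt0.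
pose k := (Num.bound `|(gam - low) / (m%:R - alpha)|).+1.
have kP : (gam - low) / (m%:R - alpha) < k%:R.
  apply: le_lt_trans (ler_norm _) _; apply: lt_trans (archi_boundP _) _ => //.
  by rewrite ltr_nat.
have := bound k isT; rewrite leNgt => /negP; apply.
by move: kP; rewrite ltr_pdivrMr //; lra.
Qed.

End Valuation.

Lemma power_sum_count (s u : seq algC) (k : nat) : uniq u -> {subset s <= u} ->
  power_sum s k = \sum_(a <- u) (count_mem a s)%:R * a ^+ k.
Proof.
move=> u_uniq; rewrite /power_sum; elim: s => [|x s IH] su.
  by rewrite big_nil big1 // => a _; rewrite mul0r.
rewrite big_cons IH => [|y ys]; last by apply: su; rewrite inE ys orbT.
under [RHS]eq_bigr do rewrite /= natrD mulrDl.
rewrite big_split /=; congr (_ + _).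
rewrite (bigD1_seq x) ?su ?mem_head //= eqxx mul1r big1 ?addr0 // => a ax.
by rewrite eq_sym (negbTE ax) mul0r.
Qed.

Lemma power_sumB (alpha beta u : seq algC) (k : nat) : uniq u -> {subset alpha ++ beta <= u} ->
  power_sum alpha k - power_sum beta k = \sum_(a <- u) multiplicityA alpha beta a * a ^+ k.
Proof.
move=> u_uniq abu; rewrite !(power_sum_count (u := u)) //.
- by rewrite -sumrB; apply: eq_bigr => a _; rewrite mulrBl.
- by move=> a ab; apply: abu; rewrite mem_cat ab orbT.
- by move=> a ab; apply: abu; rewrite mem_cat ab.
Qed.

Theorem theorem1p4 (F : finFieldType) (p : nat) (hp : p \in [pchar F])
    (K : closedFieldType) (iota : {rmorphism F -> K})
    (hK : is_algebraic_closure iota)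
    (n r : nat) (P : 'I_r -> {mpoly F[n]})
    (d : 'I_n -> nat) (hd : forall i, (0 < d i)%N)
    (hD : (0 < max_degree (fun j => total_degree (P j)))%N) :
  let q := #|F| in
  let N := partial_points iota P d in
  let m := mu d (fun j => total_degree (P j)) in
  (forall k : nat, (0 < k)%N -> ((k * m)%:R%:E <= ord_nat p q (N k))%E)
  /\
  (forall v : algC -> \bar rat, is_ord_ext p q v ->
    (divisibility_chain d ->
      forall alpha beta : seq algC, decompositionA q N alpha beta ->
      forall a : algC, a \in alpha ++ beta ->
        multiplicityA alpha beta a != 0 -> (m%:R%:E <= v a)%E)
    /\
    (forall zeta : algC, (lcm_weights d).-primitive_root zeta ->
      forall alpha beta : 'I_(lcm_weights d) -> seq algC,
        decompositionB q N zeta alpha beta ->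
      forall (j : 'I_(lcm_weights d)) (a : algC), a \in alpha j ++ beta j ->
        multiplicityB zeta alpha beta a != 0 -> (m%:R%:E <= v a)%E)).
Proof.
move=> q N m; have p_pr := pcharf_prime hp.
have [f cardF] : exists f, #|F| = (p ^ f)%N by eexists; apply: (card_pprimeChar hp).
have f0 : (0 < f)%N.
  by case: f cardF (finNzRing_gt1 F) => // ->; rewrite expn0.
have N_ord k : (0 < k)%N -> ((k * m)%:R%:E <= ord_nat p q (N k))%E.
  (* A zero count has order [+oo]. Otherwise the order is normalized by [logn p q = f], which
     absorbs the factor [f] of [f * k * m]. *)
  move=> k0; rewrite /ord_nat; case: eqP => [_|/eqP Nk]; first by rewrite leey.
  have := partial_points_dvd hp cardF f0 iota hd hD k0.
  rewrite pfactor_dvdn ?lt0n // => H.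
  rewrite /q cardF pfactorK // lee_fin ler_pdivlMr ?ltr0n // -natrM ler_nat.
  by rewrite mulnC mulnA.
split=> // v v_ord; have [_ vN _ _] := v_ord.
split=> [_ alpha beta [_ NE] a a_ab|zeta _ alpha beta [_ NE] j a a_ab] mult0.
  apply: (ord_ext_exponential_sum v_ord (undup_uniq (alpha ++ beta)) _ _ mult0); last first.
    by rewrite mem_undup.
  move=> k k0; rewrite -(power_sumB _ (undup_uniq _)) => [|x]; last by rewrite mem_undup.
  by rewrite -NE // vN; apply: N_ord.
(* The bases for all [j] are merged into one list; exchanging the sums over [j] and over the bases
   yields the coefficients [multiplicityB]. *)
pose s := undup (flatten [seq alpha j ++ beta j | j <- enum 'I_(lcm_weights d)]).
have s_mem i : {subset alpha i ++ beta i <= s}.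
  by move=> x xi; rewrite mem_undup; apply/flatten_mapP; exists i; rewrite ?mem_enum.
apply: (ord_ext_exponential_sum v_ord (undup_uniq _) _ (s_mem j a a_ab) mult0) => k k0.
suff <- : (N k)%:R = \sum_(b <- s) multiplicityB zeta alpha beta b * b ^+ k.
  by rewrite vN; apply: N_ord.
rewrite NE // /multiplicityB; under [RHS]eq_bigr do rewrite mulr_suml.
rewrite exchange_big; apply: eq_bigr => i _.
rewrite (power_sumB _ (undup_uniq _) (s_mem i)) mulr_sumr.
by apply: eq_bigr => b _; rewrite mulrA.
Qed.
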